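(* Let $k$ be a field and $X$ a well-ordered set. In the free $L$-algebra $L(X)$ let $S=F_1\cup F_2\cup F_3\cup F_4$, where $$F_1=\{a\prec(b\prec c)-a\prec(b\succ c)\mid a,b,c\in N(X)\},$$ $$F_2=\{(a\prec b)\succ c-a\succ(b\succ c)\mid a,b,c\in N(X)\},$$ $$F_3=\{(a\prec b)\prec c-a\prec(b\succ c)\mid a,b,c\in N(X)\},$$ $$F_4=\{(a\succ b)\succ c-a\succ(b\succ c)\mid a,b,c\in N(X)\}$$ (so that $L(X|S)$ is the free dialgebra $D(X)$ generated by $X$), and let $$F_5=\{a_1\prec(a_2\succ(a_3\succ\cdots\succ(a_{n+2}\prec a_{n+3})\cdots))-a_1\prec(a_2\succ(a_3\succ\cdots\succ(a_{n+2}\succ a_{n+3})\cdots))\mid n\ge 1,\ a_1,\dots,a_{n+3}\in N(X)\}.$$ Then, with the ordering on $N(X)$ described in the context, $S_1=S\cup F_5$ (its elements being scaled so as to be monic) is a Gröbner-Shirshov basis in $L(X)$.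
   Context: An $L$-algebra over $k$ is a $k$-space with two bilinear operations $\prec,\succ$ satisfying $(x\succ y)\prec z=x\succ(y\prec z)$. A dialgebra is a $k$-space with two bilinear associative operations $\prec,\succ$ satisfying $a\prec(b\succ c)=a\prec b\prec c$, $(a\prec b)\succ c=a\succ b\succ c$, $a\succ(b\prec c)=(a\succ b)\prec c$. For $T\subset L(X)$, $L(X|T)$ is the quotient of $L(X)$ by the ideal generated by $T$. Let $\Omega=\{\prec,\succ\}$. $(X,\Omega)$ (the $\Omega$-words) is the smallest set of formal expressions containing $X$ and closed under $u,v\mapsto u\prec v$, $u\succ v$. Normal words: $x\in X$; $v\succ w$ with $v,w$ normal; $v\prec w$ with $v,w$ normal and $v$ not of the form $v_1\succ v_2$. $N(X)$ is the set of normal words. The free $L$-algebra $L(X)$ has $k$-basis $N(X)$ and operations given for $u,v\in N(X)$ by: $u\succ v$ is the word $u\succ v$; $u\prec v=[u\prec v]$, where $[u\prec v]$ is the word $u\prec v$ if $u\in X$ or $u=u_1\prec u_2$, and $[u\prec v]=u_1\succ[u_2\prec v]$ if $u=u_1\succ u_2$. The expressions in $F_1,\dots,F_5$ are evaluated in $L(X)$. Ordering: $|u|$ is the number of occurrences of elements of $X$ in $u$; $\delta_1$ denotes $\succ$, $\delta_2$ denotes $\prec$, $\delta_1<\delta_2$. Put $wt(x)=(1,x)$ for $x\in X$ and $wt(u)=(|u|,\delta_i,u_1,u_2)$ for $u=\delta_i(u_1,u_2)$; $u>v$ iff $wt(u)>wt(v)$ lexicographically, recursively on $|u|+|v|$.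 For $0\ne f\in L(X)$, $\overline f$ is the largest normal word occurring in $f$; $f$ is monic if its coefficient is $1$. A $\star$-$\Omega$-word is an element of $(X\cup\{\star\},\Omega)$ ($\star\notin X$) with exactly one occurrence of $\star$. For a $\star$-$\Omega$-word $u$ and $s\in L(X)$, the $s$-word $u|_s$ is the element of $L(X)$ obtained by substituting $s$ for $\star$. It is a normal $s$-word if the $\Omega$-word $u|_{\overline s}$ (formal substitution) lies in $N(X)$. Compositions for monic $f,g\in L(X)$: (1) if $\overline f=u_1\succ u_2$ with $u_1,u_2\in N(X)$, then for any $v\in N(X)$, $f\prec v$ is a composition of right multiplication. (2) If $w=\overline f=u|_{\overline g}$ with $u|_g$ a normal $g$-word, then $(f,g)_w=f-u|_g$ is a composition of inclusion. For a monic set $T$ and $f,g\in T$: $f\prec v$ is trivial modulo $T$ if $f\prec v=\sum\alpha_iu_i|_{s_i}$ (finite sum) with $\alpha_i\in k$, $s_i\in T$, $u_i|_{s_i}$ normal $s_i$-words and $u_i|_{\overline{s_i}}\le\overline{f\prec v}$; $(f,g)_w$ is trivial modulo $(T,w)$ if it is such a sum with $u_i|_{\overline{s_i}}<w$ for all $i$. $T$ is a Gröbner-Shirshov basis in $L(X)$ if all compositions of elements of $T$ are trivial. *)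

(* Defs.v *)
From HB Require Import structures.
From mathcomp Require Import all_boot all_order all_algebra.
From mathcomp Require Import finmap.
From mathcomp.multinomials Require Import monalg.

Set Implicit Arguments.
Unset Strict Implicit.
Unset Printing Implicit Defensive.

Import Order.TTheory GRing.Theory.
Local Open Scope ring_scope.

Reserved Notation "u ≺ v" (at level 40, left associativity).
Reserved Notation "u ≻ v" (at level 40, left associativity).

Declare Scope oword_scope.
Delimit Scope oword_scope with W.
Declare Scope lalg_scope.
Delimit Scope lalg_scope with L.

Inductive oword (X : Type) : Type :=
  | Var of X
  | Prec of oword X & oword X
  | Succ of oword X & oword X.
Bind Scope oword_scope with oword.

Notation "u ≺ v" := (Prec u v) : oword_scope.
Notation "u ≻ v" := (Succ u v) : oword_scope.

Fixpoint oword_tree X (w : oword X) : GenTree.tree X :=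
  match w with
  | Var x => GenTree.Leaf x
  | Prec u v => GenTree.Node 0 [:: oword_tree u; oword_tree v]
  | Succ u v => GenTree.Node 1 [:: oword_tree u; oword_tree v]
  end.

Fixpoint tree_oword X (t : GenTree.tree X) : option (oword X) :=
  match t with
  | GenTree.Leaf x => Some (Var x)
  | GenTree.Node n [:: t1; t2] =>
      if (tree_oword t1, tree_oword t2) is (Some u, Some v)
      then Some (if n is 0%N then Prec u v else Succ u v) else None
  | _ => None
  end.

Lemma oword_treeK X : pcancel (@oword_tree X) (@tree_oword X).
Proof. by elim=> [x|u IHu v IHv|u IHu v IHv] //=; rewrite IHu IHv. Qed.

HB.instance Definition _ (X : eqType) :=
  Equality.copy (oword X) (pcan_type (@oword_treeK X)).
HB.instance Definition _ (X : choiceType) :=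
  Choice.copy (oword X) (pcan_type (@oword_treeK X)).

Fixpoint olen X (w : oword X) : nat :=
  match w with
  | Var _ => 1
  | Prec u v | Succ u v => olen u + olen v
  end.

Lemma olen_gt0 X (w : oword X) : (0 < olen w)%N.
Proof. by elim: w => //= u IHu v IHv; rewrite addn_gt0 IHu. Qed.

(* Lexicographic comparison of the weights [wt x = (1, x)] and
   [wt (δ u1 u2) = (|u|, δ, u1, u2)], where ≻ is smaller than ≺.  The cases
   comparing a letter with a compound word of the same length do not occur. *)
Fixpoint olt d (X : orderType d) (u v : oword X) : bool :=
  (olen u < olen v)%N || (olen u == olen v) &&
  match u, v with
  | Var x, Var y => (x < y)%O
  | Succ _ _, Prec _ _ => true
  | Succ u1 u2, Succ v1 v2
  | Prec u1 u2, Prec v1 v2 => olt u1 v1 || (u1 == v1) && olt u2 v2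
  | _, _ => false
  end.

Section OwordOrder.
Context {d : Order.disp_t} (X : orderType d).
Implicit Types u v w : oword X.

Lemma oltE u v : olt u v =
  (olen u < olen v)%N || (olen u == olen v) &&
  match u, v with
  | Var x, Var y => (x < y)%O
  | Succ _ _, Prec _ _ => true
  | Succ u1 u2, Succ v1 v2
  | Prec u1 u2, Prec v1 v2 => olt u1 v1 || (u1 == v1) && olt u2 v2
  | _, _ => false
  end.
Proof. by case: u. Qed.

Lemma olt_irr : irreflexive (@olt d X).
Proof.
by elim=> [x|u IHu v IHv|u IHu v IHv]; rewrite oltE ltnn !eqxx /= ?ltxx ?IHu ?IHv.
Qed.

Lemma olt_trans : transitive (@olt d X).
Proof.
move=> v u w; elim: u v w => [x|u1 IH1 u2 IH2|u1 IH1 u2 IH2] v w;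
  rewrite !oltE => /orP[Huv|/andP[/eqP Huv Huv']] /orP[Hvw|/andP[/eqP Hvw Hvw']];
  rewrite ?Huv -?Hvw ?Huv ?Hvw ?(ltn_trans Huv Hvw) // eqxx ltnn /=;
  case: v w Huv' Hvw' {Huv Hvw} => [y|v1 v2|v1 v2] [z|w1 w2|w1 w2] //;
  first exact: lt_trans.
all: move=> /orP[h1|/andP[/eqP-> h1]] /orP[h2|/andP[/eqP<- h2]];
  by rewrite ?(IH1 _ _ h1 h2) ?h1 ?h2 ?eqxx ?(IH2 _ _ h1 h2) ?orbT.
Qed.

Lemma olt_total u v : u != v -> olt u v || olt v u.
Proof.
elim: u v => [x|u1 IH1 u2 IH2|u1 IH1 u2 IH2] v; rewrite !(oltE _ v) !(oltE v);
  case: ltngtP => //= [Huv]; case: v Huv => [y|v1 v2|v1 v2] //=.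
- by move=> _ neq; rewrite -neq_lt; apply: contra neq => /eqP->.
1-2: by move=> Huv; have := leq_add (olen_gt0 v1) (olen_gt0 v2); rewrite -Huv.
1,3: by move=> Huv; have := leq_add (olen_gt0 u1) (olen_gt0 u2); rewrite Huv.
all: move=> _ neq; case: (eqVneq u1 v1) neq => [<-|ne1 _];
  last by case/orP: (IH1 _ ne1) => ->; rewrite ?orbT.
all: move=> neq; rewrite olt_irr /=; apply: IH2.
all: by apply: contra neq => /eqP->.
Qed.

End OwordOrder.

Fact oword_display : Order.disp_t. Proof. exact: (Order.Disp tt tt). Qed.

HB.instance Definition _ d (X : orderType d) :=
  Order.LtOrder.Build oword_display (oword X)
    (fun _ _ => erefl) (fun _ _ => erefl) (fun _ _ => erefl)
    (@olt_irr d X) (@olt_trans d X) (@olt_total d X).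

Definition is_succ X (w : oword X) := if w is Succ _ _ then true else false.

Fixpoint normal X (w : oword X) : bool :=
  match w with
  | Var _ => true
  | Succ v w => normal v && normal w
  | Prec v w => [&& ~~ is_succ v, normal v & normal w]
  end.

Record nword (X : Type) : Type :=
  NWord { nword_val :> oword X; nword_normal : normal nword_val }.

HB.instance Definition _ X := [isSub for @nword_val X].

(* Opaque mixins: otherwise unification in [{malg k[nword X]}] unfolds the
   comparison and choice operators and practically never terminates. *)
Fact nword_hasDecEq (X : eqType) : hasDecEq (nword X).
Proof.
exists (fun u v => val u == val v) => u v.
by apply: (iffP eqP) => [/val_inj|->].
Qed.
HB.instance Definition _ (X : eqType) := nword_hasDecEq X.

Fact nword_hasChoice (X : choiceType) : hasChoice (nword X).
Proof. exact: (PCanHasChoice (@valK _ _ (nword X))). Qed.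
HB.instance Definition _ (X : choiceType) := nword_hasChoice X.

HB.instance Definition _ d (X : orderType d) :=
  [SubChoice_isSubOrder of nword X by <: with oword_display].

(* The word written [u ≺ v] in square brackets. *)
Fixpoint oprec X (u v : oword X) : oword X :=
  if u is Succ u1 u2 then Succ u1 (oprec u2 v) else Prec u v.

Lemma normal_oprec X (u v : nword X) : normal (oprec u v).
Proof.
case: u v => u Hu [v Hv] /=.
elim: u Hu => [x|u1 _ u2 _|u1 _ u2 IH2] //=; first by move=> ->.
by case/andP=> -> /IH2.
Qed.

Lemma normal_succ X (u v : nword X) : normal (Succ u v).
Proof. by rewrite /= !nword_normal. Qed.

Definition nvar X (x : X) : nword X := @NWord X (Var x) isT.
Definition nprec X (u v : nword X) : nword X := NWord (normal_oprec u v).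
Definition nsucc X (u v : nword X) : nword X := NWord (normal_succ u v).

Notation lfree k X := {malg k[nword X]}.

Section FreeLAlgebra.
Context {k : fieldType} {X : choiceType}.
Implicit Types f g h : lfree k X.

Definition bilin (op : nword X -> nword X -> nword X) f g : lfree k X :=
  \sum_(u <- msupp f) \sum_(v <- msupp g) << f@_u * g@_v *g op u v >>.

Definition lprec := bilin (@nprec X).
Definition lsucc := bilin (@nsucc X).

End FreeLAlgebra.

Notation "f ≺ g" := (lprec f g) : lalg_scope.
Notation "f ≻ g" := (lsucc f g) : lalg_scope.

Local Open Scope lalg_scope.

Section FreeLAlgebraTheory.
Context {k : fieldType} {X : choiceType}.
Implicit Types f g h : lfree k X.

Lemma bilinEw op (D1 D2 : {fset nword X}) f g :
  fsubset (msupp f) D1 -> fsubset (msupp g) D2 ->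
  bilin op f g = \sum_(u <- D1) \sum_(v <- D2) << f@_u * g@_v *g op u v >>.
Proof.
move=> s1 s2; rewrite /bilin (big_fset_incl _ s1) => [|u _ /mcoeff_outdom u0].
  apply: eq_bigr => u _; rewrite (big_fset_incl _ s2) // => v _ /mcoeff_outdom->.
  by rewrite mulr0 monalgU0.
by apply: big1 => v _; rewrite u0 mul0r monalgU0.
Qed.

Lemma scale_malgU (c a : k) (u : nword X) : c *: << a *g u >> = << c * a *g u >>.
Proof. by apply/malgP => v; rewrite mcoeffZ !mcoeffU mulrnAr. Qed.

Lemma bilinPl op (c : k) f1 f2 g :
  bilin op (c *: f1 + f2) g = c *: bilin op f1 g + bilin op f2 g.
Proof.
pose D := fsetU (msupp (c *: f1 + f2)) (fsetU (msupp f1) (msupp f2)).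
have := fsubset_refl D; rewrite {1}/D !fsubUset => /and3P[s0 s1 s2].
rewrite !(@bilinEw _ D (msupp g)) ?fsubset_refl //.
rewrite scaler_sumr -big_split; apply: eq_bigr => u _ /=.
rewrite scaler_sumr -big_split; apply: eq_bigr => v _ /=.
by rewrite scale_malgU -monalgUD mcoeffD mcoeffZ mulrDl -mulrA.
Qed.

Lemma bilinPr op (c : k) f g1 g2 :
  bilin op f (c *: g1 + g2) = c *: bilin op f g1 + bilin op f g2.
Proof.
pose D := fsetU (msupp (c *: g1 + g2)) (fsetU (msupp g1) (msupp g2)).
have := fsubset_refl D; rewrite {1}/D !fsubUset => /and3P[s0 s1 s2].
rewrite !(@bilinEw _ (msupp f) D) ?fsubset_refl //.
rewrite scaler_sumr -big_split; apply: eq_bigr => u _ /=.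
rewrite scaler_sumr -big_split; apply: eq_bigr => v _ /=.
by rewrite scale_malgU -monalgUD mcoeffD mcoeffZ mulrDr mulrCA.
Qed.

Lemma bilinU op (a b : k) (u v : nword X) :
  bilin op << a *g u >> << b *g v >> = << a * b *g op u v >>.
Proof.
by rewrite (bilinEw _ msuppU_le msuppU_le) !big_seq_fset1 !mcoeffUU.
Qed.

Lemma bilin_suml op (I : Type) (r : seq I) (F : I -> lfree k X) g :
  bilin op (\sum_(i <- r) F i) g = \sum_(i <- r) bilin op (F i) g.
Proof.
elim/big_rec2: _ => [|i x y _ <-]; first by rewrite /bilin msupp0 big_seq_fset0.
by rewrite -[F i in LHS]scale1r bilinPl scale1r.
Qed.

Lemma bilin_sumr op (I : Type) (r : seq I) (F : I -> lfree k X) f :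
  bilin op f (\sum_(i <- r) F i) = \sum_(i <- r) bilin op f (F i).
Proof.
elim/big_rec2: _ => [|i x y _ <-].
  by rewrite /bilin msupp0; apply: big1 => u _; rewrite big_seq_fset0.
by rewrite -[F i in LHS]scale1r bilinPr scale1r.
Qed.

Lemma lsucc_lprec f g h : (f ≻ g) ≺ h = f ≻ (g ≺ h).
Proof.
rewrite (monalgE f) (monalgE g) (monalgE h) /lsucc /lprec.
rewrite !bilin_suml; apply: eq_bigr => u _.
rewrite (bilin_sumr (@nsucc X)) !(bilin_suml (@nprec X)).
rewrite (bilin_sumr (@nsucc X)); apply: eq_bigr => v _.
rewrite !(bilin_sumr (@nprec X)) (bilin_sumr (@nsucc X)); apply: eq_bigr => w _.
rewrite !bilinU mulrA; congr << _ *g _ >>; exact: val_inj.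
Qed.

End FreeLAlgebraTheory.

Section GroebnerShirshov.
Context {k : fieldType} {d : Order.disp_t} {X : orderType d}.
Implicit Types (f g h s : lfree k X) (T : lfree k X -> Prop).

Definition lead f : option (nword X) := ohead (sort >=%O (msupp f)).

Lemma leadP f w : lead f = Some w <->
  w \in msupp f /\ (forall v, v \in msupp f -> (v <= w)%O).
Proof.
have ge_tr : transitive (>=%O : rel (nword X)) by move=> x y z h /le_trans; apply.
have ge_tot : total (>=%O : rel (nword X)) by move=> x y; apply: le_total.
rewrite /lead; have := mem_sort >=%O (msupp f).
have := sort_sorted ge_tot (msupp f).
case: (sort _ _) => [|x r] /= sr E; first by split=> // -[]; rewrite -E.
have le_x v : v \in msupp f -> (v <= x)%O.
  rewrite -E inE => /predU1P[->|v_r]; first exact: lexx.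
  by move: sr; rewrite path_sortedE // => /andP[/allP/(_ v v_r)].
have x_f : x \in msupp f by rewrite -E mem_head.
split=> [[<-]|[w_f le_w]] //; congr Some; apply: le_anti.
by rewrite le_w ?le_x.
Qed.

Lemma lead_eq0 f : lead f = None <-> f = 0.
Proof.
split=> [|->]; last by rewrite /lead msupp0.
move=> f0; rewrite [f]monalgE big_seq big1 // => v.
by rewrite -(mem_sort >=%O); move: f0; rewrite /lead; case: (sort _ _).
Qed.

Definition lcoef f : k := if lead f is Some w then f@_w else 0.

Definition lmonic f := lcoef f == 1.

(* A ⋆-Ω-word is an Ω-word on [option X] with a single occurrence of the
   letter ⋆ = [None]. *)
Fixpoint nstar (u : oword (option X)) : nat :=
  match u with
  | Var x => (x == None)
  | Prec u v | Succ u v => nstar u + nstar v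
  end.

Definition star_word u := nstar u == 1%N.

(* Formal substitution, without the rewriting done by [oprec]. *)
Fixpoint plug (u : oword (option X)) (w : oword X) : oword X :=
  match u with
  | Var (Some x) => Var x
  | Var None => w
  | Prec u v => Prec (plug u w) (plug v w)
  | Succ u v => Succ (plug u w) (plug v w)
  end.

(* [u|_s], evaluated in the free L-algebra. *)
Fixpoint sword (u : oword (option X)) s : lfree k X :=
  match u with
  | Var (Some x) => << nvar x >>
  | Var None => s
  | Prec u v => sword u s ≺ sword v s
  | Succ u v => sword u s ≻ sword v s
  end.

(* [u|_{s̄}], where s̄ is the leading word of [s]. *)
Definition plug_lead u s : option (oword X) :=
  omap (fun w : nword X => plug u w) (lead s).

Definition normal_sword u s : bool :=
  star_word u && oapp (@normal X) false (plug_lead u s).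

(* [h] is a finite sum of terms [a_i u_i|_{s_i}] with [s_i] in [T], with
   [u_i|_{s_i}] a normal s-word, and with [u_i|_{s̄_i}] satisfying [B]. *)
Definition nsword_sum T (B : oword X -> Prop) h : Prop :=
  exists n (a : 'I_n -> k) (u : 'I_n -> oword (option X)) (s : 'I_n -> lfree k X),
    (forall i, [/\ T (s i), normal_sword (u i) (s i)
                & exists2 w, plug_lead (u i) (s i) = Some w & B w])
    /\ h = \sum_(i < n) a i *: sword (u i) (s i).

Definition right_mult_trivial T f (v : nword X) : Prop :=
  nsword_sum T
    (fun w => exists2 w0, lead (f ≺ << v >>) = Some w0 & (w <= val w0)%O)
    (f ≺ << v >>).

Definition inclusion_trivial T f g u (w : nword X) : Prop :=
  nsword_sum T (fun w' => (w' < val w)%O) (f - sword u g).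

Definition groebner_shirshov T : Prop :=
  [/\ forall f, T f -> lmonic f,
      forall f (u1 u2 : nword X), T f -> lead f = Some (nsucc u1 u2) ->
        forall v, right_mult_trivial T f v
    & forall f g u w, T f -> T g -> lead f = Some w ->
        normal_sword u g -> plug_lead u g = Some (val w) ->
        inclusion_trivial T f g u w].

End GroebnerShirshov.

Section Relations.
Context {k : fieldType} {d : Order.disp_t} {X : orderType d}.
Implicit Types f g : lfree k X.

Definition F1 f := exists a b c : nword X,
  f = << a >> ≺ (<< b >> ≺ << c >>) - << a >> ≺ (<< b >> ≻ << c >>).

Definition F2 f := exists a b c : nword X,
  f = (<< a >> ≺ << b >>) ≻ << c >> - << a >> ≻ (<< b >> ≻ << c >>).

Definition F3 f := exists a b c : nword X,
  f = (<< a >> ≺ << b >>) ≺ << c >> - << a >> ≺ (<< b >> ≻ << c >>).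

Definition F4 f := exists a b c : nword X,
  f = (<< a >> ≻ << b >>) ≻ << c >> - << a >> ≻ (<< b >> ≻ << c >>).

(* [a 2 ≻ (a 3 ≻ ... (a n.+1 ≻ t))] *)
Definition succ_chain (a : nat -> nword X) n (t : lfree k X) : lfree k X :=
  foldr (fun i g => << a i >> ≻ g) t (iota 2 n).

Definition F5 f := exists2 n, (1 <= n)%N & exists a : nat -> nword X,
  f = << a 1 >> ≺ succ_chain a n (<< a n.+2 >> ≺ << a n.+3 >>)
    - << a 1 >> ≺ succ_chain a n (<< a n.+2 >> ≻ << a n.+3 >>).

Definition relS f := F1 f \/ F2 f \/ F3 f \/ F4 f.

(* Scaled by the inverse leading coefficient. *)
Definition relS1 f := exists2 g, relS g \/ F5 g & f = (lcoef g)^-1 *: g.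

End Relations.

(* Main.v *)
Require Import Defs.
From mathcomp Require Import all_boot all_order all_algebra.
From mathcomp Require Import finmap.
From mathcomp.multinomials Require Import monalg.

Set Implicit Arguments.
Unset Strict Implicit.
Unset Printing Implicit Defensive.

Import Order.TTheory GRing.Theory.
Local Open Scope ring_scope.
Local Open Scope lalg_scope.

(** Every relation of S_1 is a difference of two normal words, and both words
have the same image in the free dialgebra D(X).  Here D(X) is given by its
standard model, words of letters with one marked letter ([diword], [dprec],
[dsucc]): the marked letter of s ≺ t is that of s, the marked letter of s ≻ t
is that of t, and [diw] is the evaluation.  So each monic element of S_1 is a
[binom p q], that is p - q, with q < p and [diw q = diw p] ([relS1_binom]).

A normal s-word built on p - q is again such a difference w - z, with w the
formal substitution of p and z < w, because the operations are monotone along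
normal s-words ([sword_binom]).  Hence subtracting it is one step of rewriting
words, which replaces w by the smaller word z and preserves [diw].

A word that admits no such step is standard, that is, of the form
x_1 ≻ (... (x_m ≻ (c ≺ (y_1 ≻ (... ≻ y_n))))) or x_1 ≻ (... (x_m ≻ c)) with
letters x_i, c, y_j ([reducible_or_std]), and there is one standard word
[std_word] for each marked word.  This is what F_5 is needed for: without it,
x ≺ (y ≻ (b ≺ c)) and x ≺ (y ≻ (b ≻ c)), for letters x, y, b, c, would be two
distinct irreducible words with the same image.

Since the order is well founded, rewriting ends at the standard word of
[diw w], so w - std_word (diw w) is a combination of normal s-words with
leading words at most w ([binom_std]).  Therefore any p - q with
[diw p = diw q] is a combination of normal s-words bounded by p and q
([nsword_sum_binom]).

Every composition is of this form.  If f = p - q, then f ≺ v is the difference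
of the words of p ≺ v and q ≺ v.  If f = w - q and u|_g = w - z, then
f - u|_g = z - q, and z and q are both smaller than w. *)

(** * Normal words and their order *)

Section Order.
Context {d : Order.disp_t} {X : orderType d}.
Implicit Types u v w : oword X.
Implicit Types a b c p q : nword X.

Lemma olen_oprec u v : olen (oprec u v) = (olen u + olen v)%N.
Proof. by elim: u => //= u1 _ u2 ->; rewrite addnA. Qed.

Lemma ltn_olenDr u v : (olen u < olen u + olen v)%N.
Proof. by rewrite -addn1 leq_add2l olen_gt0. Qed.

Lemma ltn_olenDl u v : (olen v < olen u + olen v)%N.
Proof. by rewrite addnC ltn_olenDr. Qed.

Lemma olt_olen u v : olt u v -> (olen u <= olen v)%N.
Proof. by rewrite oltE; case: ltngtP. Qed.

Lemma olt_Succl w u v : olt u v -> olt (Succ u w) (Succ v w).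
Proof.
move=> uv; rewrite oltE /= ltn_add2r eqn_add2r uv andbT orbC -leq_eqVlt.
exact: olt_olen.
Qed.

Lemma olt_Succr w u v : olt u v -> olt (Succ w u) (Succ w v).
Proof.
move=> uv; rewrite oltE /= ltn_add2l eqn_add2l uv eqxx orbT andbT orbC.
by rewrite -leq_eqVlt olt_olen.
Qed.

Lemma olt_Precl w u v : olt u v -> olt (Prec u w) (Prec v w).
Proof.
move=> uv; rewrite oltE /= ltn_add2r eqn_add2r uv andbT orbC -leq_eqVlt.
exact: olt_olen.
Qed.

Lemma olt_Precr w u v : olt u v -> olt (Prec w u) (Prec w v).
Proof.
move=> uv; rewrite oltE /= ltn_add2l eqn_add2l uv eqxx orbT andbT orbC.
by rewrite -leq_eqVlt olt_olen.
Qed.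

Lemma olt_oprecr w u v : olt u v -> olt (oprec w u) (oprec w v).
Proof.
move=> uv; elim: w => [x|w1 _ w2 _|w1 _ w2 IH] /=; last exact: olt_Succr.
all: exact: olt_Precr.
Qed.

Lemma olt_Succ_olen u1 u2 v1 v2 :
  (olen u1 + olen u2 = olen v1 + olen v2)%N -> (olen u1 < olen v1)%N ->
  olt (Succ u1 u2) (Succ v1 v2).
Proof.
move=> eq_len lt_len; rewrite oltE [olen (Succ u1 u2)]eq_len eqxx.
by rewrite [olt u1 v1]oltE lt_len orbT.
Qed.

Lemma olt_Prec_olen u1 u2 v1 v2 :
  (olen u1 + olen u2 = olen v1 + olen v2)%N -> (olen u1 < olen v1)%N ->
  olt (Prec u1 u2) (Prec v1 v2).
Proof.
move=> eq_len lt_len; rewrite oltE [olen (Prec u1 u2)]eq_len eqxx.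
by rewrite [olt u1 v1]oltE lt_len orbT.
Qed.

Lemma olt_Succ_Prec u v : olt (Succ u v) (Prec u v).
Proof. by rewrite oltE eqxx orbT. Qed.

Lemma oprec_nsucc u v : ~~ is_succ u -> oprec u v = Prec u v.
Proof. by case: u. Qed.

(** The word v has to be no ≻-word, for then the product v ≺ w is formal.  If u
is a ≻-word of the same length as v, the bracket pushes w inside u and yields a
≻-word, which is smaller than the ≺-word v ≺ w whatever its components are. *)
Lemma olt_oprecl w u v : ~~ is_succ v -> olt u v -> olt (oprec u w) (oprec v w).
Proof.
move=> nv uv; rewrite (oprec_nsucc _ nv).
case: (boolP (is_succ u)) => nu; last first.
  by rewrite oprec_nsucc //; apply: olt_Precl.
rewrite oltE olen_oprec /= ltn_add2r eqn_add2r.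
by case: u nu {uv}(olt_olen uv) => // u1 u2 _ le; rewrite andbT orbC -leq_eqVlt.
Qed.

Lemma oprec_inj w : injective (oprec w).
Proof. by elim: w => [x|w1 _ w2 _|w1 _ w2 IH] u v /= [] // /IH. Qed.

Lemma oprec_neq_Succ u v : oprec u v <> Succ u v.
Proof.
case: u => //= u1 u2 [E _]; have := ltn_olenDr u1 u2.
by rewrite {1}E /= ltnn.
Qed.

Lemma oprec_oprec_neq u v w z : oprec (oprec u v) w <> oprec u z.
Proof.
elim: u => [x|u1 _ u2 _|u1 _ u2 IH] //= [] // E _.
by have := ltn_olenDr u1 u2; rewrite -{1}E ltnn.
Qed.

(** Nested induction on the two components: words of smaller length are
accessible by hypothesis, so the second component may be arbitrary when the
first one decreases.  The first disjunct covers the predecessors w with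
another head operation. *)
Lemma Acc_olt_compound (op : oword X -> oword X -> oword X) n :
    (forall u v, olen (op u v) = (olen u + olen v)%N) ->
    (forall w u v,
       olt w (op u v) -> olen w = olen (op u v) -> (olen w <= n)%N ->
       Acc (@olt d X) w \/
       exists u' v', w = op u' v' /\ (olt u' u \/ u' = u /\ olt v' v)) ->
    (forall w, (olen w < n)%N -> Acc (@olt d X) w) ->
  forall u v, (olen (op u v) <= n)%N -> Acc (@olt d X) (op u v).
Proof.
move=> olen_op lt_op small u v le; have acc_u : Acc (@olt d X) u.
  by apply: small; apply: leq_trans le; rewrite olen_op ltn_olenDr.
elim: acc_u v le => {}u _ IHu v le; have acc_v : Acc (@olt d X) v.
  by apply: small; apply: leq_trans le; rewrite olen_op ltn_olenDl.
elim: acc_v le => {}v _ IHv le; constructor=> w lt_w.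
move: (olt_olen lt_w); rewrite leq_eqVlt => /orP[/eqP eq_w|]; last first.
  by move=> len_w; apply: small; apply: leq_trans le.
case: (lt_op _ _ _ lt_w eq_w) => [|//|[u' [v' [Ew lt_uv]]]].
  by rewrite eq_w.
rewrite Ew in eq_w *; rewrite -eq_w in le.
by case: lt_uv => [lt_u|[Eu lt_v]]; [apply: IHu|rewrite Eu in le *; apply: IHv].
Qed.

Lemma Acc_olt_Succ n :
    (forall w, (olen w < n)%N -> Acc (@olt d X) w) ->
  forall u v, (olen (Succ u v) <= n)%N -> Acc (@olt d X) (Succ u v).
Proof.
apply: Acc_olt_compound => // w u v; rewrite oltE => lt_w eq_w _.
move: lt_w; rewrite eq_w ltnn eqxx /=.
case: w eq_w => // u' v' _ lt_uv; right; exists u', v'; split=> //.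
by case/orP: lt_uv => [|/andP[/eqP]]; [left|right].
Qed.

(** A ≺-word also lies above all the ≻-words of its length, so [Acc_olt_Succ]
comes first. *)
Lemma Acc_olt_Prec n :
    (forall w, (olen w < n)%N -> Acc (@olt d X) w) ->
  forall u v, (olen (Prec u v) <= n)%N -> Acc (@olt d X) (Prec u v).
Proof.
move=> small; apply: Acc_olt_compound => // w u v.
rewrite oltE => lt_w eq_w le_w; move: lt_w; rewrite eq_w ltnn eqxx /=.
case: w eq_w le_w => // u' v' _ le_w lt_uv; last first.
  by left; apply: Acc_olt_Succ le_w.
right; exists u', v'; split=> //.
by case/orP: lt_uv => [|/andP[/eqP]]; [left|right].
Qed.

Lemma olt_wf : well_founded (fun x y : X => (x < y)%O) ->
  well_founded (@olt d X).
Proof.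
move=> X_wo u; have [n] := ubnP (olen u); elim: n u => [u|n IHn u le_n].
  by rewrite ltn0.
case: u le_n => [x|u1 u2|u1 u2] le_n; last 2 first.
- by clear X_wo; apply: (Acc_olt_Prec IHn).
- by clear X_wo; apply: (Acc_olt_Succ IHn).
elim: (X_wo x) => {X_wo le_n}x _ IH; constructor=> -[y|v1 v2|v1 v2].
- by rewrite oltE /= => /IH.
- by rewrite oltE /= andbF orbF ltnNge (leq_add (olen_gt0 v1)).
- by rewrite oltE /= andbF orbF ltnNge (leq_add (olen_gt0 v1)).
Qed.

Lemma nword_wf : well_founded (@olt d X) ->
  well_founded (fun a b : nword X => (a < b)%O).
Proof.
move=> wf a; move Eu: (val a) => u.
elim: (wf u) a Eu => {}u _ IH a Eu; constructor=> b ba.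
by apply: (IH (val b)) => //; rewrite -Eu.
Qed.

Lemma nword_PrecP c u v : val c = Prec u v ->
  exists a b, [/\ val a = u, val b = v, ~~ is_succ a & c = nprec a b].
Proof.
move=> Ew; have := nword_normal c.
rewrite -[nword_val c]/(val c) Ew => /and3P[su nu nv].
exists (NWord nu), (NWord nv); split=> //.
by apply: val_inj; rewrite Ew /= oprec_nsucc.
Qed.

Lemma nword_SuccP c u v : val c = Succ u v ->
  exists a b, [/\ val a = u, val b = v & c = nsucc a b].
Proof.
move=> Ew; have := nword_normal c.
rewrite -[nword_val c]/(val c) Ew => /andP[nu nv].
exists (NWord nu), (NWord nv); split=> //.
exact: val_inj.
Qed.

Lemma nword_ltE a b : (a < b)%O = olt (val a) (val b).
Proof. by []. Qed.

Lemma ltr_nprec a p q : (q < p)%O -> (nprec a q < nprec a p)%O.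
Proof. by rewrite !nword_ltE; apply: olt_oprecr. Qed.

Lemma ltl_nprec a p q : ~~ is_succ p -> (q < p)%O -> (nprec q a < nprec p a)%O.
Proof. by rewrite !nword_ltE; apply: olt_oprecl. Qed.

Lemma ltr_nsucc a p q : (q < p)%O -> (nsucc a q < nsucc a p)%O.
Proof. by rewrite !nword_ltE; apply: olt_Succr. Qed.

Lemma ltl_nsucc a p q : (q < p)%O -> (nsucc q a < nsucc p a)%O.
Proof. by rewrite !nword_ltE; apply: olt_Succl. Qed.

End Order.

(** * The free dialgebra and its standard words *)

Section Diwords.
Context (X : Type).

(** A word l c r with marked letter c: the free dialgebra on X has these words
as a basis. *)
Definition diword : Type := seq X * X * seq X.
Implicit Types s t : diword.

Definition letters t : seq X := t.1.1 ++ t.1.2 :: t.2.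
Definition dprec s t : diword := (s.1, s.2 ++ letters t).
Definition dsucc s t : diword := ((letters s ++ t.1.1, t.1.2), t.2).

Fixpoint diw (w : oword X) : diword :=
  match w with
  | Var x => ([::], x, [::])
  | Prec u v => dprec (diw u) (diw v)
  | Succ u v => dsucc (diw u) (diw v)
  end.

Lemma letters_dprec s t : letters (dprec s t) = letters s ++ letters t.
Proof. by rewrite /letters /= -catA. Qed.

Lemma letters_dsucc s t : letters (dsucc s t) = letters s ++ letters t.
Proof. by rewrite /letters /= -catA. Qed.

Lemma dprec_letters (s t t' : diword) :
  letters t = letters t' -> dprec s t = dprec s t'.
Proof. by rewrite /dprec => ->. Qed.

Lemma dsucc_letters (s s' t : diword) :
  letters s = letters s' -> dsucc s t = dsucc s' t.
Proof. by rewrite /dsucc => ->. Qed.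

Lemma dsuccA (s t r : diword) : dsucc (dsucc s t) r = dsucc s (dsucc t r).
Proof. by rewrite /dsucc letters_dsucc /= catA. Qed.

Lemma dprecA (s t r : diword) : dprec (dprec s t) r = dprec s (dprec t r).
Proof. by rewrite /dprec letters_dprec /= catA. Qed.

Lemma letters_dprec_dsucc (s t : diword) :
  letters (dprec s t) = letters (dsucc s t).
Proof. by rewrite letters_dprec letters_dsucc. Qed.

(** Rewriting u ≺ v to its normal form uses only the L-algebra axiom, which the
free dialgebra satisfies. *)
Lemma diw_oprec u v : diw (oprec u v) = dprec (diw u) (diw v).
Proof. by elim: u => //= u1 _ u2 ->. Qed.

Definition succ_letters (l : seq X) (w : oword X) : oword X :=
  foldr (fun x => Succ (Var x)) w l.

(** The word x_1 ≻ (... (x_m ≻ (c ≺ (y_1 ≻ (... ≻ y_n))))); the product of the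
y_j ends in its own last letter, hence [belast] and [last]. *)
Definition std_word t : oword X :=
  succ_letters t.1.1
    (if t.2 is y :: r
     then Prec (Var t.1.2) (succ_letters (belast y r) (Var (last y r)))
     else Var t.1.2).

Lemma normal_succ_letters l w : normal (succ_letters l w) = normal w.
Proof. by elim: l. Qed.

Lemma normal_std_word t : normal (std_word t).
Proof.
case: t => [[l c] [|y r]]; rewrite normal_succ_letters //=.
by rewrite normal_succ_letters.
Qed.

Definition std_nword t : nword X := NWord (normal_std_word t).

End Diwords.

(** * Combinations of normal s-words *)

Section SwordSums.
Context {k : fieldType} {d : Order.disp_t} {X : orderType d}.
Implicit Types (f g h : lfree k X) (T : lfree k X -> Prop).
Implicit Types (B : oword X -> Prop).

Lemma nsword_sum0 T B : nsword_sum T B 0.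
Proof.
exists 0%N, (fun=> 0), (fun=> Var None), (fun=> 0).
by split; [case|rewrite big_ord0].
Qed.

Lemma nsword_sum1 T B u s w : T s -> normal_sword u s ->
  plug_lead u s = Some w -> B w -> nsword_sum T B (sword u s).
Proof.
move=> Ts us uw Bw; exists 1%N, (fun=> 1), (fun=> u), (fun=> s).
by split=> [_|]; [split=> //; exists w|rewrite big_ord1 scale1r].
Qed.

Lemma nsword_sumD T B f g :
  nsword_sum T B f -> nsword_sum T B g -> nsword_sum T B (f + g).
Proof.
move=> [n [a [u [s [P ->]]]]] [m [b [v [t [Q ->]]]]].
pose glue I (x : 'I_n -> I) (y : 'I_m -> I) i :=
  match split i with inl j => x j | inr j => y j end.
exists (n + m)%N, (glue _ a b), (glue _ u v), (glue _ s t).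
split=> [i|]; first by rewrite /glue; case: (split i).
rewrite [RHS]big_split_ord; apply: f_equal2; apply: eq_bigr => i _.
  by rewrite /glue (unsplitK (inl i)).
by rewrite /glue (unsplitK (inr i)).
Qed.

Lemma nsword_sumN T B f : nsword_sum T B f -> nsword_sum T B (- f).
Proof.
move=> [n [a [u [s [P ->]]]]]; exists n, (fun i => - a i), u, s; split=> //.
by rewrite -sumrN; apply: eq_bigr => i _; rewrite scaleNr.
Qed.

Lemma nsword_sumW T (B B' : oword X -> Prop) f :
  (forall w, B w -> B' w) -> nsword_sum T B f -> nsword_sum T B' f.
Proof.
move=> BB' [n [a [u [s [P Ef]]]]]; exists n, a, u, s; split=> // i.
by case: (P i) => Ts us [w uw Bw]; split=> //; exists w => //; apply: BB'.
Qed.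

End SwordSums.

(** * Differences of two words *)

Section Binomials.
Context {k : fieldType} {d : Order.disp_t} {X : orderType d}.
Implicit Types (f g h : lfree k X) (a b c p q w z : nword X).

Definition binom p q : lfree k X := << p >> - << q >>.

Lemma lprecU a b : << a >> ≺ << b >> = << nprec a b >> :> lfree k X.
Proof. by rewrite /lprec bilinU mulr1. Qed.

Lemma lsuccU a b : << a >> ≻ << b >> = << nsucc a b >> :> lfree k X.
Proof. by rewrite /lsucc bilinU mulr1. Qed.

Lemma bilinBl op f g h : bilin op (f - g) h = bilin op f h - bilin op g h.
Proof. by rewrite addrC -scaleN1r bilinPl scaleN1r addrC. Qed.

Lemma bilinBr op f g h : bilin op f (g - h) = bilin op f g - bilin op f h.
Proof. by rewrite addrC -scaleN1r bilinPr scaleN1r addrC. Qed.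

Lemma mcoeff_binom p q w : (binom p q)@_w = (p == w)%:R - (q == w)%:R.
Proof. by rewrite /binom mcoeffB !mcoeffU. Qed.

Lemma lead_binom p q : (q < p)%O -> lead (binom p q) = Some p.
Proof.
move=> qp; apply/leadP; split=> [|v]; rewrite -mcoeff_neq0 mcoeff_binom.
  by rewrite eqxx (lt_eqF qp) subr0 oner_neq0.
by case: (eqVneq p v) => [->|_] //; case: (eqVneq q v) => [<-|];
  rewrite ?(ltW qp) // subrr eqxx.
Qed.

Lemma lcoef_binom p q : (q < p)%O -> lcoef (binom p q) = 1.
Proof.
by move=> qp; rewrite /lcoef lead_binom // mcoeff_binom eqxx (lt_eqF qp) subr0.
Qed.

Lemma lead_opp f : lead (- f) = lead f.
Proof. by rewrite /lead msuppN. Qed.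

Lemma binomN p q : - binom p q = binom q p.
Proof. exact: opprB. Qed.

Lemma lcoef_binomN p q : (q < p)%O -> lcoef (binom q p) = -1.
Proof.
move=> qp; rewrite -(binomN p q) /lcoef lead_opp lead_binom // mcoeffN.
by rewrite mcoeff_binom eqxx (lt_eqF qp) subr0.
Qed.

Lemma lead_binom_ge p q : p != q ->
  exists w, [/\ lead (binom p q) = Some w, (p <= w)%O & (q <= w)%O].
Proof.
rewrite neq_lt => /orP[] lt_pq.
  by exists q; rewrite -(binomN q p) lead_opp lead_binom // lexx ltW.
by exists p; rewrite lead_binom // lexx ltW.
Qed.

Lemma scaled_binom p q : p != q ->
  exists p' q', [/\ (q' < p')%O, (p' = p /\ q' = q) \/ (p' = q /\ q' = p)
                  & (lcoef (binom p q))^-1 *: binom p q = binom p' q'].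
Proof.
rewrite neq_lt => /orP[] lt_pq.
  exists q, p; split; [by []|by right|].
  by rewrite lcoef_binomN // invrN1 scaleN1r binomN.
by exists p, q; split; [|left|rewrite lcoef_binom // invr1 scale1r].
Qed.

End Binomials.

(** * The relations as differences of two words *)

Section Relations.
Context {k : fieldType} {d : Order.disp_t} {X : orderType d}.
Implicit Types (f g h : lfree k X) (a b c p q w z : nword X).

Definition nsucc_chain (a : nat -> nword X) n (t : nword X) : nword X :=
  foldr (fun i => nsucc (a i)) t (iota 2 n).

Lemma succ_chainU (a : nat -> nword X) n t :
  succ_chain a n (<< t >> : lfree k X) = << nsucc_chain a n t >>.
Proof.
rewrite /succ_chain /nsucc_chain; elim: (iota 2 n) => //= i r ->.
by rewrite lsuccU.
Qed.

Lemma nsucc_chain_inj (a : nat -> nword X) n : injective (nsucc_chain a n).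
Proof.
move=> t t'; rewrite /nsucc_chain; elim: (iota 2 n) => //= i r IH.
by move/(congr1 val) => /= -[E]; apply/IH/val_inj.
Qed.

Lemma letters_nsucc_chain (a : nat -> nword X) n (t t' : nword X) :
  letters (diw t) = letters (diw t') ->
  letters (diw (nsucc_chain a n t)) = letters (diw (nsucc_chain a n t')).
Proof.
move=> E; rewrite /nsucc_chain; elim: (iota 2 n) => //= i r IH.
by rewrite !letters_dsucc IH.
Qed.

Lemma nprec_inj a : injective (nprec a).
Proof. by move=> u v /(congr1 val) /= /oprec_inj /val_inj. Qed.

Lemma nprec_neq_nsucc a b : nprec a b <> nsucc a b.
Proof. by move/(congr1 val); apply: oprec_neq_Succ. Qed.

Definition unscaled_relS1 g := relS g \/ F5 g.

(** F_1 to F_4 are dialgebra identities, or consequences of them: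
to the right of ≺ and to the left of ≻ only the letters count, not the mark, so
≺ and ≻ may be exchanged there.  The same remark, applied below a chain of ≻,
gives F_5.  The two words are distinct because their left factors have distinct
lengths, or because a bracketed product is never the formal ≻-word on the same
factors. *)
Lemma rel_binom g : unscaled_relS1 g ->
  exists p q, [/\ g = binom p q, p <> q & diw p = diw q].
Proof.
case=> [[|[|[|]]]|].
- move=> [a [b [c ->]]]; rewrite !(lprecU, lsuccU).
  exists (nprec a (nprec b c)), (nprec a (nsucc b c)); split=> //.
    by move/nprec_inj/nprec_neq_nsucc.
  rewrite /= !diw_oprec; apply/dprec_letters.
  exact: letters_dprec_dsucc.
- move=> [a [b [c ->]]]; rewrite !(lprecU, lsuccU).
  exists (nsucc (nprec a b) c), (nsucc a (nsucc b c)); split=> //.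
    move/(congr1 val) => /= [E _].
    by have := ltn_olenDr a b; rewrite -olen_oprec E ltnn.
  by rewrite /= !diw_oprec -dsuccA; apply/dsucc_letters/letters_dprec_dsucc.
- move=> [a [b [c ->]]]; rewrite !(lprecU, lsuccU).
  exists (nprec (nprec a b) c), (nprec a (nsucc b c)); split=> //.
    by move/(congr1 val)/oprec_oprec_neq.
  by rewrite /= !diw_oprec dprecA; apply/dprec_letters/letters_dprec_dsucc.
- move=> [a [b [c ->]]]; rewrite !(lprecU, lsuccU).
  exists (nsucc (nsucc a b) c), (nsucc a (nsucc b c)); split=> //.
    move/(congr1 val) => /= [E _].
    by have := ltn_olenDr a b; rewrite -{1}E ltnn.
  exact: dsuccA.
- move=> [n _ [a ->]]; rewrite !(lprecU, lsuccU, succ_chainU).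
  eexists; eexists; split; first by [].
    by move/nprec_inj/nsucc_chain_inj/nprec_neq_nsucc.
  rewrite /= !diw_oprec; apply/dprec_letters/letters_nsucc_chain.
  by rewrite /= diw_oprec letters_dprec_dsucc.
Qed.

Lemma relS1_binom f : relS1 f ->
  exists p q, [/\ f = binom p q, (q < p)%O & diw q = diw p].
Proof.
move=> [g /rel_binom [p [q [-> /eqP neq_pq Epq]]] ->].
have [p' [q' [lt_qp Eqp ->]]] := @scaled_binom k _ _ _ _ neq_pq.
by exists p', q'; split=> //; case: Eqp => [[-> ->]|[-> ->]].
Qed.

(** Which of the two words of a relation is the larger one depends on the
shape of the factors, so the relation may come with either sign before it is
made monic. *)
Lemma binom_relS1 p q : (q < p)%O ->
  unscaled_relS1 (binom p q) \/ unscaled_relS1 (binom q p) ->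
  relS1 (binom p q : lfree k X).
Proof.
move=> lt_qp [] rel.
  by exists (binom p q) => //; rewrite lcoef_binom // invr1 scale1r.
by exists (binom q p) => //; rewrite lcoef_binomN // invrN1 scaleN1r binomN.
Qed.

End Relations.

(** * Normal s-words as differences of two words *)

Section NormalSwords.
Context {k : fieldType} {d : Order.disp_t} {X : orderType d}.
Implicit Types (f g h s : lfree k X) (a b c p q w z : nword X).

Lemma sword_nostar (u : oword (option X)) s (x : oword X) w :
  nstar u = 0%N -> val w = plug u x -> sword u s = << w >>.
Proof.
elim: u w => [[y|]|u IHu v IHv|u IHu v IHv] w //=.
- by move=> _ Ew; congr << _ >>; apply: val_inj.
- move/eqP; rewrite addn_eq0 => /andP[/eqP u0 /eqP v0].
  move=> /nword_PrecP[a [b [Ea Eb _ ->]]].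
  by rewrite (IHu a) // (IHv b) // lprecU.
- move/eqP; rewrite addn_eq0 => /andP[/eqP u0 /eqP v0].
  move=> /nword_SuccP[a [b [Ea Eb ->]]].
  by rewrite (IHu a) // (IHv b) // lsuccU.
Qed.

(** Monotonicity of the two operations along the path to ⋆.  Normality of the
substituted word w is what makes the left factor of each ≺ on this path no
≻-word, as [ltl_nprec] requires. *)
Lemma sword_binom (u : oword (option X)) p q w :
  (q < p)%O -> diw q = diw p -> star_word u -> val w = plug u p ->
  exists z, [/\ (z < w)%O, diw z = diw w
              & sword u (binom p q : lfree k X) = binom w z].
Proof.
move=> lt_qp Eqp; rewrite /star_word.
elim: u w => [[y|]|u IHu v IHv|u IHu v IHv] w //=.
- by move=> _ /val_inj->; exists q.
- rewrite addn_eq1 => /orP[]/andP[/eqP Nu /eqP Nv].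
  + move=> /nword_PrecP[a [b [Ea Eb sa ->]]].
    have [|//|z [lt_z Ez ->]] := IHu a; first by rewrite Nu.
    exists (nprec z b); split; [exact: ltl_nprec|by rewrite /= !diw_oprec Ez|].
    by rewrite (sword_nostar _ Nv Eb) /lprec bilinBl -!/(lprec _ _) !lprecU.
  + move=> /nword_PrecP[a [b [Ea Eb _ ->]]].
    have [|//|z [lt_z Ez ->]] := IHv b; first by rewrite Nv.
    exists (nprec a z); split; [exact: ltr_nprec|by rewrite /= !diw_oprec Ez|].
    by rewrite (sword_nostar _ Nu Ea) /lprec bilinBr -!/(lprec _ _) !lprecU.
- rewrite addn_eq1 => /orP[]/andP[/eqP Nu /eqP Nv].
  + move=> /nword_SuccP[a [b [Ea Eb ->]]].
    have [|//|z [lt_z Ez ->]] := IHu a; first by rewrite Nu.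
    exists (nsucc z b); split; [exact: ltl_nsucc|by rewrite /= Ez|].
    by rewrite (sword_nostar _ Nv Eb) /lsucc bilinBl -!/(lsucc _ _) !lsuccU.
  + move=> /nword_SuccP[a [b [Ea Eb ->]]].
    have [|//|z [lt_z Ez ->]] := IHv b; first by rewrite Nv.
    exists (nsucc a z); split; [exact: ltr_nsucc|by rewrite /= Ez|].
    by rewrite (sword_nostar _ Nu Ea) /lsucc bilinBr -!/(lsucc _ _) !lsuccU.
Qed.

End NormalSwords.

(** * Reduction to standard words *)

Section Reduction.
Context {k : fieldType} {d : Order.disp_t} {X : orderType d}.
Implicit Types (f g h s : lfree k X) (a b c p q w z : nword X).

Definition reducible (u : oword X) := exists v f p,
  [/\ star_word v, relS1 f, lead f = Some p & u = plug v p].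

Fixpoint star_free (u : oword X) : oword (option X) :=
  match u with
  | Var x => Var (Some x)
  | Prec u v => Prec (star_free u) (star_free v)
  | Succ u v => Succ (star_free u) (star_free v)
  end.

Lemma plug_star_free (u v : oword X) : plug (star_free u) v = u.
Proof. by elim: u => //= u1 -> u2 ->. Qed.

Lemma nstar_star_free (u : oword X) : nstar (star_free u) = 0%N.
Proof. by elim: u => //= u1 -> u2 ->. Qed.

Lemma reducible_lead p q : (q < p)%O ->
  unscaled_relS1 (binom p q : lfree k X) \/
    unscaled_relS1 (binom q p : lfree k X) ->
  reducible (val p).
Proof.
by move=> lt_qp rel; exists (Var None), (binom p q), p; split;
  rewrite ?lead_binom //; apply: binom_relS1.
Qed.

Lemma reducible_Precr (u v : oword X) : reducible v -> reducible (Prec u v).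
Proof.
move=> [t [f [p [t1 rel lead_f ->]]]]; exists (Prec (star_free u) t), f, p.
by split=> //=; rewrite ?plug_star_free // /star_word /= nstar_star_free.
Qed.

Lemma reducible_Succr (u v : oword X) : reducible v -> reducible (Succ u v).
Proof.
move=> [t [f [p [t1 rel lead_f ->]]]]; exists (Succ (star_free u) t), f, p.
by split=> //=; rewrite ?plug_star_free // /star_word /= nstar_star_free.
Qed.

(** Among the leading words of the relations, those of [reducible_F1] to
[reducible_F5] suffice to recognise every nonstandard normal word.  Other ones
occur: if b is a ≻-word, that of F_1 is a ≺ (b ≻ c), which is already reducible
by F_4. *)
Lemma reducible_F2 a b c : reducible (Succ (oprec a b) c).
Proof.
apply: (@reducible_lead (nsucc (nprec a b) c) (nsucc a (nsucc b c))).
  apply: olt_Succ_olen; first by rewrite /= olen_oprec addnA.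
  by rewrite /= olen_oprec ltn_olenDr.
by left; left; right; left; exists a, b, c; rewrite !(lprecU, lsuccU).
Qed.

Lemma reducible_F4 a b c : reducible (Succ (Succ a b) c).
Proof.
apply: (@reducible_lead (nsucc (nsucc a b) c) (nsucc a (nsucc b c))).
  apply: olt_Succ_olen; first by rewrite /= addnA.
  by rewrite /= ltn_olenDr.
by left; left; right; right; right; exists a, b, c; rewrite !(lprecU, lsuccU).
Qed.

Lemma reducible_F3 a b c : ~~ is_succ a -> reducible (Prec (Prec a b) c).
Proof.
move=> sa; have := @reducible_lead (nprec (nprec a b) c) (nprec a (nsucc b c)).
rewrite /= !oprec_nsucc //; apply.
  rewrite nword_ltE -[val _]/(oprec a (Succ b c)).
  rewrite -[val (nprec _ c)]/(oprec (oprec a b) c).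
  rewrite !(oprec_nsucc _ sa); apply: olt_Prec_olen; first by rewrite /= addnA.
  by rewrite /= ltn_olenDr.
by left; left; right; right; left; exists a, b, c; rewrite !(lprecU, lsuccU).
Qed.

Lemma reducible_F1 a b c : ~~ is_succ a -> ~~ is_succ b ->
  reducible (Prec a (Prec b c)).
Proof.
move=> sa sb.
have := @reducible_lead (nprec a (nprec b c)) (nprec a (nsucc b c)).
rewrite /= !oprec_nsucc //; apply.
  apply: ltr_nprec; rewrite nword_ltE -[val (nprec b c)]/(oprec b c).
  by rewrite oprec_nsucc // olt_Succ_Prec.
by left; left; left; exists a, b, c; rewrite !(lprecU, lsuccU).
Qed.

(** F_5 numbers its factors from 1, whereas a list is indexed from 0; the
factors a_2, ..., a_(n+1) are then the letters of l. *)
Lemma val_nsucc_chain (l : seq X) (x c : X) t0 t :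
  val (nsucc_chain (fun i => nth t0 (map (@nvar X) (x :: rcons l c)) i.-1)
         (size l) t) = succ_letters l (val t).
Proof.
pose a i := nth t0 (map (@nvar X) (x :: rcons l c)) i.-1.
have -> : nsucc_chain a (size l) t = foldr (fun y => nsucc (nvar y)) t l.
  rewrite /nsucc_chain -(foldr_map a (@nsucc X)).
  rewrite -(foldr_map (@nvar X) (@nsucc X)).
  congr foldr; rewrite (iotaDl 1 1) -map_comp /=.
  rewrite (@map_nth_iota _ _ (map (@nvar X) (x :: rcons l c))).
    by rewrite /= drop0 map_rcons -cats1 take_size_cat ?size_map.
  by rewrite /= size_map size_rcons subn1.
by rewrite /succ_letters; elim: l {a} => //= y l ->.
Qed.

Lemma reducible_F5 (x : X) (l : seq X) (c : X) (t : nword X) :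
  (0 < size l)%N ->
  reducible (Prec (Var x) (succ_letters l (Prec (Var c) t))).
Proof.
move=> l_gt0.
(* The factors a_1, ..., a_(n+3) of F_5 are x, the letters of l, c and t; the
   last one is obtained as the default value past the end of the list. *)
pose a i := nth t (map (@nvar X) (x :: rcons l c)) i.-1.
have an2 : a (size l).+2 = nvar c.
  by rewrite /a map_cons /= map_rcons nth_rcons size_map ltnn eqxx.
have an3 : a (size l).+3 = t.
  by rewrite /a nth_default // size_map /= size_rcons.
have := @reducible_lead
  (nprec (nvar x) (nsucc_chain a (size l) (nprec (nvar c) t)))
  (nprec (nvar x) (nsucc_chain a (size l) (nsucc (nvar c) t))).
rewrite -[val (nprec _ _)]/(Prec (Var x) (val (nsucc_chain a _ _))).
rewrite val_nsucc_chain; apply.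
  apply: ltr_nprec; rewrite /nsucc_chain; elim: (iota _ _) => /= [|i r IH].
    by rewrite nword_ltE; apply: olt_Succ_Prec.
  exact: ltr_nsucc.
left; right; exists (size l) => //; exists a.
by rewrite an2 an3 !(lprecU, lsuccU, succ_chainU).
Qed.

(** When x stands to the left of ≺, the mark of an unbranched word
l_1 ≻ (... ≻ c) is forgotten and c becomes the last of the letters on the right
of x. *)
Lemma std_word_var_rcons (x : X) (l : seq X) (c : X) :
  std_word ([::], x, rcons l c) = Prec (Var x) (succ_letters l (Var c)).
Proof. by case: l => // y l; rewrite /std_word /= belast_rcons last_rcons. Qed.

(** A left factor that is no letter is reducible by F_2 or F_4 under ≻, and by
F_3 under ≺.  There remains x ≻ v, standard with v, and x ≺ v with v standard:
if v contains no ≺ the word is standard, and otherwise its ≺ comes directly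
below x (F_1) or after some letters (F_5). *)
Lemma reducible_or_std (w : oword X) :
  normal w -> reducible w \/ w = std_word (diw w).
Proof.
elim: w => [x|u _ v IHv|u _ v IHv]; first by right.
- case/and3P=> su nu nv; have [red_v|Ev] := IHv nv.
    by left; apply: reducible_Precr.
  case: u su nu => // [x _ _|u1 u2 _ nu]; last first.
    case/and3P: nu => su1 nu1 nu2; left.
    exact: (@reducible_F3 (NWord nu1) (NWord nu2) (NWord nv)).
  rewrite /=; case: (diw v) Ev => [[l c] [|y r]] Ev; subst v.
    by right; rewrite /dprec /letters /= cats1 std_word_var_rcons.
  left; rewrite /std_word [_.2]/=.
  have nt : normal (succ_letters (belast y r) (Var (last y r))).
    by rewrite normal_succ_letters.
  case: l {nv IHv} => [|y' l].
    exact: (@reducible_F1 (nvar x) (nvar c) (NWord nt)).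
  exact: (@reducible_F5 x (y' :: l) c (NWord nt)).
- case/andP=> nu nv; have [red_v|Ev] := IHv nv.
    by left; apply: reducible_Succr.
  case: u nu => [x _|u1 u2 nu|u1 u2 nu].
  + by right; rewrite {1}Ev.
  + case/and3P: nu => su1 nu1 nu2; left; rewrite -(oprec_nsucc u2 su1).
    exact: (@reducible_F2 (NWord nu1) (NWord nu2) (NWord nv)).
  + case/andP: nu => nu1 nu2; left.
    exact: (@reducible_F4 (NWord nu1) (NWord nu2) (NWord nv)).
Qed.

(** Well-founded induction on w: subtracting a normal s-word with leading word
w leaves z - std_word (diw z) with z < w. *)
Lemma binom_std w : well_founded (fun a b : nword X => (a < b)%O) ->
  nsword_sum (@relS1 k d X) (fun v => (v <= val w)%O)
    (binom w (std_nword (diw w))).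
Proof.
move=> lt_wf; elim: (lt_wf w) => {lt_wf}w _ IH.
have [[v [f [p [v1 rel lead_f Ew]]]]|Ew] := reducible_or_std (nword_normal w).
- have [p' [q [Ef lt_qp Eqp]]] := relS1_binom rel.
  move: lead_f; rewrite Ef lead_binom // => -[Ep']; subst p'.
  have [z [lt_zw Ez Esz]] := @sword_binom k d X _ _ _ _ lt_qp Eqp v1 Ew.
  rewrite Ef in rel.
  have -> : binom w (std_nword (diw w)) =
      sword v (binom p q : lfree k X) + binom z (std_nword (diw z)).
    by rewrite Esz Ez /binom addrA subrK.
  have lead_v : plug_lead v (binom p q : lfree k X) = Some (val w).
    by rewrite /plug_lead lead_binom //= -Ew.
  apply: nsword_sumD.
    apply: (nsword_sum1 rel _ lead_v) => //.
    by rewrite /normal_sword v1 lead_v /= nword_normal.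
  apply: nsword_sumW (IH z lt_zw) => t /le_trans; apply; exact: ltW.
- suff <- : w = std_nword (diw w) by rewrite /binom subrr; apply: nsword_sum0.
  exact: val_inj.
Qed.

Lemma nsword_sum_binom (B : oword X -> Prop) p q :
  well_founded (fun a b : nword X => (a < b)%O) ->
  diw p = diw q ->
  (forall v, (v <= val p)%O -> B v) -> (forall v, (v <= val q)%O -> B v) ->
  nsword_sum (@relS1 k d X) B (binom p q).
Proof.
move=> lt_wf Epq Bp Bq.
have -> : binom p q = binom p (std_nword (diw p))
                    - binom q (std_nword (diw q)) :> lfree k X.
  by rewrite /binom -Epq opprB addrA subrK.
apply: nsword_sumD; first exact: nsword_sumW (binom_std p lt_wf).
by apply: nsword_sumN; apply: nsword_sumW (binom_std q lt_wf).
Qed.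

End Reduction.

Theorem theorem5p6 (k : fieldType) (d : Order.disp_t) (X : orderType d)
    (X_wo : well_founded (fun x y : X => (x < y)%O)) :
  groebner_shirshov (@relS1 k d X).
Proof.
have lt_wf := nword_wf (olt_wf X_wo).
split.
- move=> f /relS1_binom[p [q [-> lt_qp _]]].
  by rewrite /lmonic lcoef_binom.
- move=> f u1 u2 /relS1_binom[p [q [-> lt_qp Eqp]]] _ v.
  rewrite /right_mult_trivial.
  have -> : binom p q ≺ << v >> = binom (nprec p v) (nprec q v) :> lfree k X.
    by rewrite /lprec bilinBl -!/(lprec _ _) !lprecU.
  have [->|neq] := eqVneq (nprec p v) (nprec q v).
    by rewrite /binom subrr; apply: nsword_sum0.
  apply: nsword_sum_binom => //; first by rewrite /= !diw_oprec Eqp.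
  + have [w0 [-> le_p _]] := @lead_binom_ge k _ _ _ _ neq.
    by move=> t le_t; exists w0 => //; apply: le_trans le_t le_p.
  + have [w0 [-> _ le_q]] := @lead_binom_ge k _ _ _ _ neq.
    by move=> t le_t; exists w0 => //; apply: le_trans le_t le_q.
- move=> f g u w Sf Sg.
  have [p [q [-> lt_qp Eqp]]] := relS1_binom Sf.
  have [p' [q' [-> lt_qp' Eqp']]] := relS1_binom Sg.
  rewrite lead_binom // /normal_sword /plug_lead lead_binom //.
  move=> -[<-] /andP[u1 _].
  case=> Ep; have [z [lt_z Ez Esz]] :=
    @sword_binom k d X _ _ _ _ lt_qp' Eqp' u1 (esym Ep).
  rewrite /inclusion_trivial Esz.
  have -> : binom p q - binom p z = binom z q :> lfree k X.
    by rewrite /binom opprB addrC addrA subrK.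
  apply: nsword_sum_binom => //; first by rewrite Ez Eqp.
  + by move=> t /le_lt_trans; apply.
  + by move=> t /le_lt_trans; apply.
Qed.
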